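(* Let $b$ be a function with domain $\omega$ with $b(i)\neq\emptyset$ for all $i$, and $h\in\omega^\omega$ with $h\geq^*1$ and $h(i)<|b(i)|$ for all but finitely many $i$. If the sequence $\langle h(i)/|b(i)|:i<\omega\rangle$ does not converge to $0$ (where $h(i)/|b(i)|:=0$ when $b(i)$ is infinite), then $\mathfrak{b}^{\mathrm{aLc}}_{b,h}=N$, where $N$ is the least natural number such that $B_N:=\{i<\omega:|b(i)|\leq N\cdot h(i)\}$ is infinite, and $\mathfrak{d}^{\mathrm{aLc}}_{b,h}=\mathfrak{c}$.
   Context: $\prod b=\prod_i b(i)$; $\mathcal{S}(b,h)=\prod_i[b(i)]^{\leq h(i)}$; $\varphi\not\ni^* x$ means $x(i)\notin\varphi(i)$ for all but finitely many $i$. $\mathfrak{b}^{\mathrm{aLc}}_{b,h}$ is the least size of an $F\subseteq\mathcal{S}(b,h)$ such that no $x\in\prod b$ satisfies $\varphi\not\ni^*x$ for all $\varphi\in F$; $\mathfrak{d}^{\mathrm{aLc}}_{b,h}$ is the least size of a $D\subseteq\prod b$ such that for every $\varphi\in\mathcal{S}(b,h)$ there is $x\in D$ with $\varphi\not\ni^*x$. $\mathfrak{c}=2^{\aleph_0}$. *)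

(* Defs.v *)
From HB Require Import structures.
From mathcomp Require Import all_boot all_order all_algebra.
From mathcomp Require Import finmap.
From mathcomp Require Import all_classical all_reals all_analysis.

Set Implicit Arguments.
Unset Strict Implicit.
Unset Printing Implicit Defensive.

Import Order.TTheory GRing.Theory Num.Theory.
Import numFieldNormedType.Exports.

Local Open Scope classical_set_scope.
Local Open Scope card_scope.
Local Open Scope ring_scope.

(* Cardinals are represented by sets considered up to equipotence [#=];
   the natural number n is the cardinal of `I_n = {k | k < n}. *)
Definition card_lt (U V : Type) (A : set U) (B : set V) : bool :=
  (A #<= B) && ~~ (B #<= A).

(* "The least size of a set A satisfying P exists and equals |K|." *)
Definition least_size (U V : Type) (P : set (set U)) (K : set V) : Prop :=
  (exists2 A, P A & A #= K) /\ (forall A, P A -> K #<= A).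

Definition continuum : set (nat -> bool) := [set: nat -> bool].

Section AntiLocalization.
Context {T : choiceType}.
Implicit Types (b : nat -> set T) (h : nat -> nat).

Definition prodset b : set (nat -> T) := [set x | forall i, b i (x i)].

Definition slaloms b h : set (nat -> set T) :=
  [set phi | forall i, phi i `<=` b i /\ phi i #<= `I_(h i)].

(* phi \not\ni^* x *)
Definition evt_avoids (phi : nat -> set T) (x : nat -> T) : Prop :=
  \forall i \near \oo, ~ phi i (x i).

(* b^aLc_{b,h} = |K| *)
Definition baLc_is b h (V : Type) (K : set V) : Prop :=
  least_size [set F | F `<=` slaloms b h /\
    ~ (exists2 x, prodset b x & forall phi, F phi -> evt_avoids phi x)] K.

(* d^aLc_{b,h} = |K| *)
Definition daLc_is b h (V : Type) (K : set V) : Prop :=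
  least_size [set D | D `<=` prodset b /\
    forall phi, slaloms b h phi -> exists2 x, D x & evt_avoids phi x] K.

(* h(i)/|b(i)|, with value 0 when b(i) is infinite *)
Definition h_ratio (R : realType) b h : nat -> R := fun i =>
  if `[< finite_set (b i) >] then (h i)%:R / (#|` fset_set (b i)|)%:R else 0.

Definition Bset b h (N : nat) : set nat := [set i | b i #<= `I_(N * h i)%N].

End AntiLocalization.

(* Main.v *)
Require Import Defs.
From HB Require Import structures.
From mathcomp Require Import all_boot all_order all_algebra.
From mathcomp Require Import finmap.
From mathcomp Require Import all_classical all_reals all_analysis.

Set Implicit Arguments.
Unset Strict Implicit.
Unset Printing Implicit Defensive.

Import Order.TTheory GRing.Theory Num.Theory.
Import numFieldNormedType.Exports.

Local Open Scope classical_set_scope.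
Local Open Scope card_scope.
Local Open Scope ring_scope.

(** For [i] in [B_N], the set [b i] is a union of [N] pieces of size at most
    [h i].  The [N] slaloms made of the [k]-th pieces cannot all be avoided by
    the same [x], while [M < N] slaloms cover at most [M * h i < |b i|] points
    of [b i] for almost all [i]; hence b^aLc = N.

    Selecting one of the [N] pieces at each [i] still gives a slalom.  An
    independent family of continuum many selections is such that any [N] of
    them select all [N] pieces at infinitely many [i] in [B_N].  Thus each [x]
    avoids fewer than [N] of these slaloms, and a family avoiding all of them
    has size at least the continuum by Koenig's argument.  Conversely, when
    each [b i] is replaced by a suitable countable subset, the product has size
    at most the continuum and still has a point avoiding any given slalom. *)

Lemma pchoice_on {T : Type} {U : pointedType} (A : set T) (P : T -> U -> Prop) :
  (forall t, A t -> exists u, P t u) ->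
  {f : T -> U & forall t, A t -> P t (f t)}.
Proof.
move=> AP; apply: (choice (P := fun t u => A t -> P t u)) => t.
have [/AP[u Ptu]|nAt] := pselect (A t).
  by exists u.
by exists point.
Qed.

Lemma pcard_le_injP {T : Type} {U : pointedType} (A : set T) (B : set U) :
  reflect (exists2 f : T -> U, set_fun A B f & set_inj A f) (A #<= B).
Proof. by apply: (iffP pcard_leP) => /injfunPex. Qed.

Lemma card_le_bigcup_II {I T : Type} (D : set I) (F : I -> set T) (m n : nat) :
  D #<= `I_m -> (forall i, D i -> F i #<= `I_n) ->
  \bigcup_(i in D) F i #<= `I_(m * n).
Proof.
elim/Ppointed: I => I in D F *.
  by rewrite (empty_eq0 D) bigcup_set0 => _ _; exact: card_ge0.
move=> /pcard_le_injP[rank rank_lt rank_inj] Fn.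
have /pchoice_on[pos posP] : forall i, D i ->
    exists q : T -> nat, set_fun (F i) `I_n q /\ set_inj (F i) q.
  by move=> i /Fn/pcard_le_injP[q]; exists q.
have /pchoice_on[c cP] : forall t, (\bigcup_(i in D) F i) t ->
    exists i, D i /\ F i t.
  by move=> t [i Di Fit]; exists i.
have pos_lt t : (\bigcup_(i in D) F i) t -> (pos (c t) t < n)%N.
  by move=> /cP[/posP[+ _]]; exact.
apply/pcard_le_injP; exists (fun t => rank (c t) * n + pos (c t) t)%N.
  move=> t Ft; have posn := pos_lt t Ft.
  have n_gt0 := leq_ltn_trans (leq0n _) posn.
  rewrite /= -ltn_divLR// divnMDl// divn_small// addn0.
  by apply: rank_lt; have [] := cP t Ft.
move=> s t /set_mem Fs /set_mem Ft /(congr1 (edivn^~ n)).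
rewrite !edivn_eq ?pos_lt// => -[].
have [[Ds Fcs] [Dt Fct]] := (cP s Fs, cP t Ft).
move=> /rank_inj; rewrite !inE => /(_ Ds Dt) cst; rewrite -cst in Fct *.
by have [_] := posP _ Ds; apply; rewrite inE.
Qed.

Lemma card_le_II_mul_bigcup {T : Type} (A : set T) (m n : nat) :
  A #<= `I_(m * n) ->
  exists2 P : nat -> set T, forall k, P k #<= `I_n & A = \bigcup_(k < m) P k.
Proof.
move=> /pcard_le_injP[f f_lt f_inj].
have n_gt0 t : A t -> (0 < n)%N by move=> /f_lt /=; case: (n); rewrite ?muln0.
exists (fun k => [set t | A t /\ (f t %/ n)%N = k]).
  move=> k; apply/pcard_le_injP; exists (fun t => f t %% n)%N.
    by move=> t [/n_gt0]; rewrite -(ltn_mod (f t)).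
  move=> s t /set_mem[As sk] /set_mem[At tk] st; apply: f_inj; rewrite ?inE//.
  by rewrite (divn_eq (f s) n) sk -tk st -divn_eq.
apply/seteqP; split=> [t At|t [k _ []]//]; exists (f t %/ n)%N => //=.
by rewrite ltn_divLR ?(n_gt0 t)//; exact: f_lt.
Qed.

Lemma countable_subset_card_le_II {T : Type} (A : set T) :
  exists B : set T, [/\ B `<=` A, countable B &
    forall n, B #<= `I_n -> A #<= `I_n].
Proof.
have [Afin|A_oo] := pselect (finite_set A).
  by exists A; split=> //; exact: finite_set_countable.
elim/Ppointed: T => T in A A_oo *; first by case: A_oo; rewrite emptyE.
have /infiniteP/pcard_le_injP[f fA f_inj] := A_oo.
have range_nat := inj_card_eq f_inj.
exists (range f); split=> [_ [k _ <-]||n].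
- exact: fA.
- by rewrite /countable (card_le_eql range_nat).
- rewrite (card_le_eql range_nat) => natn; case: infinite_nat.
  by apply/finite_set_leP; exists n.
Qed.

Lemma near_inftyP (P : set nat) :
  (\forall n \near \oo, P n) <-> cofinite_set P.
Proof.
split=> [[k _ kP]|/finite_fsetP[X PX]].
  apply: sub_finite_set (finite_II k) => n nP /=.
  by rewrite ltnNge; apply/negP => /kP.
exists (\max_(i <- X) i).+1 => // n Xn; apply: contrapT => nP.
have : [set` X] n by rewrite -PX.
move=> /(@leq_bigmax_seq _ _ xpredT id) /(_ isT).
by rewrite leqNgt Xn.
Qed.

Lemma finite_set_near_notin (A : set nat) :
  finite_set A -> \forall n \near \oo, ~ A n.
Proof. by rewrite -{1}[A]setCK => /near_inftyP. Qed.

Lemma infinite_setI_near (A P : set nat) :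
  infinite_set A -> (\forall n \near \oo, P n) -> infinite_set (A `&` P).
Proof. by move=> A_oo /near_inftyP; exact: infinite_setIl. Qed.

Lemma infinite_set_near_inj {T : Type} (u : nat -> T) (A : set T) :
  injective u -> (\forall n \near \oo, A (u n)) -> infinite_set A.
Proof.
move=> u_inj Au Afin; apply: (infinite_setI_near infinite_nat Au).
by apply: finite_setIr; apply: finite_preimage Afin => m n _ _; exact: u_inj.
Qed.

Lemma near_mkseq_inj (K : choiceType) (s : seq (nat -> K)) :
  \forall n \near \oo, {in s &, injective (fun a => mkseq a n)}.
Proof.
have separated (a c : nat -> K) :
    \forall n \near \oo, mkseq a n = mkseq c n -> a = c.
  have [->|/eqP ac] := eqVneq a c; first exact: nearW.
  have [i aci] : exists i, a i <> c i by apply/existsNP => /funext.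
  exists i.+1 => // n /= lt_in acn; case: aci.
  by rewrite -(nth_mkseq (a i) a lt_in) acn nth_mkseq.
have : \forall n \near \oo, forall p : seq_sub s * seq_sub s,
    mkseq (val p.1) n = mkseq (val p.2) n -> val p.1 = val p.2.
  by apply: filter_forall => p; exact: separated.
by apply: filterS => n sep a c sa sc /(sep (SeqSub sa, SeqSub sc)).
Qed.

Definition independent_on {I V : eqType} (A : set nat)
    (f : I -> nat -> V) : Prop :=
  forall (s : seq I) (v : I -> V),
    infinite_set (A `&` [set i | {in s, forall t, f t i = v t}]).

(* [m] codes a level [n] of the binary tree, a list of nodes of that level and a
   list of values; the branch [a] takes the value listed for its node. *)
Definition branch_value (a : nat -> bool) (m : nat) : nat :=
  if choice.unpickle m is Some (n, nodes, values) then
    nth 0%N (values : seq nat) (index (mkseq a n) (nodes : seq (seq bool)))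
  else 0%N.

Lemma independent_on_branch_value : independent_on setT branch_value.
Proof.
move=> s v; rewrite setTI.
pose code n := choice.pickle (n, [seq mkseq a n | a <- s], map v s).
apply: (@infinite_set_near_inj _ code).
  by move=> m n /(pcan_inj choice.pickleK) [].
apply: filterS (near_mkseq_inj s) => n s_inj a sa /=.
have : mkseq a n \in [seq mkseq c n | c <- s] by exact: (map_f _ sa).
rewrite -index_mem size_map => lt_index.
rewrite /branch_value /code choice.pickleK (nth_map point)//.
by rewrite nth_index_map.
Qed.

Lemma exists_independent_on (A : set nat) : infinite_set A ->
  exists f : (nat -> bool) -> nat -> nat, independent_on A f.
Proof.
move=> /infiniteP/pcard_surjP[g g_surj].
exists (fun a i => branch_value a (g i)) => s v; apply/infiniteP.
have /infiniteP := @independent_on_branch_value s v.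
move=> /card_le_trans; apply.
apply/pcard_surjP; exists g => m [_ mP].
by have [i Ai gi] := g_surj m I; exists i => //; split => //=; rewrite gi.
Qed.

(* Koenig: if for every [k] some [y k] differs from the [k]-th section of the
   [k]-th element of every [E x], then the function with sections [y k] is not
   covered. *)
Lemma card_le_countable_cover {T : Type} {V : pointedType} (D : set T)
    (E : T -> set (nat -> V)) :
  (forall x, D x -> countable (E x)) -> \bigcup_(x in D) E x = setT ->
  [set: nat -> V] #<= D.
Proof.
move=> Ecount Ecover; apply: contrapT => nVD.
have /pchoice_on[e eP] : forall x, D x ->
    exists e : nat -> nat -> V, set_surj setT (E x) e.
  by move=> x /Ecount/pcard_surjP.
pose sec (k : nat) (z : nat -> V) (m : nat) := z (choice.pickle (k, m)).
have /choice[y yP] k : exists y : nat -> V, forall x, D x -> sec k (e x k) <> y.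
  apply: contrapT => ny; apply: nVD; apply/pcard_surjP.
  exists (fun x => sec k (e x k)) => y _ /=; apply: contrapT => nyx.
  by apply: ny; exists y => x Dx exy; apply: nyx; exists x.
pose z n := if choice.unpickle n is Some (k, m) then y k m else point.
have [x Dx /(eP x Dx)[k _ ekz]] : (\bigcup_(x in D) E x) z by rewrite Ecover.
apply: (yP k x Dx); apply/funext => m.
by rewrite /sec ekz /z choice.pickleK.
Qed.

Lemma least_size_Cantor_Bernstein {U V : Type} (P : set (set U)) (K : set V) :
  (exists2 A, P A & A #<= K) -> (forall A, P A -> K #<= A) -> least_size P K.
Proof.
move=> [A PA AK] Kmin; split=> //; exists A => //.
by apply: Cantor_Bernstein => //; exact: Kmin.
Qed.

Section AntiLocalizationTheory.
Context {T : choiceType}.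
Implicit Types (b c : nat -> set T) (h : nat -> nat) (phi : nat -> set T)
  (x : nat -> T) (F : set (nat -> set T)) (D : set (nat -> T)).

Definition unavoidable_family b h : set (set (nat -> set T)) :=
  [set F | F `<=` slaloms b h /\
    ~ (exists2 x, prodset b x & forall phi, F phi -> evt_avoids phi x)].

Definition avoiding_family b h : set (set (nat -> T)) :=
  [set D | D `<=` prodset b /\
    forall phi, slaloms b h phi -> exists2 x, D x & evt_avoids phi x].

Lemma exists_evt_avoids b phi :
  (forall i, b i !=set0) -> (\forall i \near \oo, ~ (b i `<=` phi i)) ->
  exists2 x, prodset b x & evt_avoids phi x.
Proof.
move=> b_neq0 nbphi.
have /choice[x xP] i : exists t, b i t /\ (~ (b i `<=` phi i) -> ~ phi i t).
  have [bphi|/nonsubset[t [bt nphit]]] := pselect (b i `<=` phi i).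
    by have [t bt] := b_neq0 i; exists t.
  by exists t.
exists x => [i|]; first by have [] := xP i.
by apply: filterS nbphi => i; have [] := xP i.
Qed.

Lemma card_prodset_le_continuum c :
  (forall i, countable (c i)) -> prodset c #<= continuum.
Proof.
move=> c_count.
have /choice[code codeP] i : exists f : T -> nat, set_inj (c i) f.
  by have /countable_injP := c_count i.
pose graph x n :=
  if choice.unpickle n is Some (i, k) then code i (x i) == k else false.
apply/pcard_le_injP; exists graph => // x y /set_mem cx /set_mem cy xy.
apply/funext => i; apply: codeP; rewrite ?inE//.
have := congr1 (@^~ (choice.pickle (i, code i (x i)))) xy.
by rewrite /graph choice.pickleK eqxx => /esym/eqP.
Qed.

Lemma few_slaloms_avoidable b h M F :
  (forall i, b i !=set0) -> finite_set (Bset b h M) ->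
  F `<=` slaloms b h -> F #<= `I_M ->
  exists2 x, prodset b x & forall phi, F phi -> evt_avoids phi x.
Proof.
move=> b_neq0 BMfin FS FM.
have [|x bx xF] :=
    @exists_evt_avoids b (fun i => \bigcup_(phi in F) phi i) b_neq0.
  apply: filterS (finite_set_near_notin BMfin) => i nBi bF; apply: nBi.
  apply: card_le_trans (subset_card_le bF) _; apply: card_le_bigcup_II FM _.
  by move=> phi /FS/(_ i)[].
exists x => // phi Fphi; apply: filterS xF => i; apply: contra_not => phix.
by exists phi.
Qed.

Definition slalom_cover b h N (P : nat -> nat -> set T) : Prop :=
  (forall k, slaloms b h (P k)) /\
  (forall i, Bset b h N i -> b i `<=` \bigcup_(k < N) P k i).

Lemma exists_slalom_cover b h N : exists P, slalom_cover b h N P.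
Proof.
have /choice[Q QP] i : exists Q : nat -> set T,
    (forall k, Q k `<=` b i /\ Q k #<= `I_(h i)) /\
    (Bset b h N i -> b i `<=` \bigcup_(k < N) Q k).
  have [Bi|nBi] := pselect (Bset b h N i); last first.
    by exists (fun=> set0); split=> // k; split=> //; exact: card_ge0.
  have [piece piece_le b_pieces] := card_le_II_mul_bigcup Bi.
  exists (fun k => b i `&` piece k); split=> [k|_ t bt].
    by split=> //; apply: card_le_trans (piece_le k); exact: subset_card_le.
  by have := bt; rewrite {1}b_pieces => -[k kN piece_t]; exists k.
exists (fun k i => Q i k); split=> [k i|i]; first exact: (QP i).1.
exact: (QP i).2.
Qed.

Lemma slalom_cover_not_evt_avoids b h N P (f : nat -> nat -> nat) x :
  slalom_cover b h N P -> prodset b x ->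
  infinite_set (Bset b h N `&` [set i | forall k, (k < N)%N -> f k i = k]) ->
  exists2 k, (k < N)%N & ~ evt_avoids (fun i => P (f k i) i) x.
Proof.
move=> [_ Pcover] bx diag_oo; apply: contrapT => all_avoided.
have : \forall i \near \oo, forall k : 'I_N, ~ P (f k i) i (x i).
  apply: filter_forall => k; apply: contrapT => not_avoided.
  by apply: all_avoided; exists k.
move=> /(infinite_setI_near diag_oo) /infinite_setN0[i [[Bi fi] nP]].
have [k kN Pk] := Pcover i Bi _ (bx i).
by apply: (nP (Ordinal kN)); rewrite /= fi.
Qed.

Lemma unavoidable_family_le_II b h N : infinite_set (Bset b h N) ->
  exists2 F, unavoidable_family b h F & F #<= `I_N.
Proof.
move=> BN; have [P Pcover] := exists_slalom_cover b h N.
exists (P @` `I_N); last exact: card_image_le.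
split=> [_ [k _ <-]|[x bx avoided]]; first exact: Pcover.1.
have [|k kN] := @slalom_cover_not_evt_avoids _ _ _ _ (fun k _ => k) _ Pcover bx.
  by apply: sub_infinite_set BN => i Bi.
by apply; apply: avoided; exists k.
Qed.

Lemma baLc_is_least_Bset b h N :
  (forall i, b i !=set0) -> infinite_set (Bset b h N) ->
  (forall M, infinite_set (Bset b h M) -> (N <= M)%N) -> baLc_is b h `I_N.
Proof.
move=> b_neq0 BN Nmin.
apply: least_size_Cantor_Bernstein; first exact: unavoidable_family_le_II.
move=> F [FS Fx]; have [[M FM]|/infiniteP F_oo] := pselect (finite_set F).
  rewrite (card_le_eqr FM) card_le_II; apply: Nmin => BMfin; apply: Fx.
  by apply: few_slaloms_avoidable BMfin FS _ => //; rewrite (card_le_eql FM).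
by apply: card_le_trans F_oo; exact: card_leT.
Qed.

Lemma finite_evt_avoids_selections {I : pointedType} b h N P
    (f : I -> nat -> nat) x :
  slalom_cover b h N P -> prodset b x -> independent_on (Bset b h N) f ->
  finite_set [set a | evt_avoids (fun i => P (f a i) i) x].
Proof.
move=> Pcover bx f_indep.
apply: contrapT => /(@infinite_set_fset _ _ N)[s s_avoided leNs].
have [|k kN] := @slalom_cover_not_evt_avoids _ _ _ _
    (fun k => f (nth point s k)) _ Pcover bx.
  apply: sub_infinite_set (f_indep s (index^~ s)) => i [Bi fi]; split=> // k kN.
  have ks := leq_trans kN leNs.
  by rewrite (fi _ (mem_nth point ks)) index_uniq// fset_uniq.
by apply; apply: s_avoided; rewrite /= mem_nth// (leq_trans kN).
Qed.

Lemma avoiding_family_ge_continuum b h N D :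
  infinite_set (Bset b h N) -> avoiding_family b h D -> continuum #<= D.
Proof.
move=> BN [Db Davoids]; have [P Pcover] := exists_slalom_cover b h N.
have [f f_indep] := exists_independent_on BN.
pose phi a i := P (f a i) i.
apply: (@card_le_countable_cover _ _ _
  (fun x => [set a | evt_avoids (phi a) x])).
  move=> x /Db bx; apply: finite_set_countable.
  exact: finite_evt_avoids_selections Pcover bx f_indep.
rewrite -subTset => a _; apply: Davoids => i; exact: Pcover.1.
Qed.

Lemma avoiding_family_le_continuum b h :
  (forall i, b i !=set0) -> (\forall i \near \oo, card_lt `I_(h i) (b i)) ->
  exists2 D, avoiding_family b h D & D #<= continuum.
Proof.
move=> b_neq0 h_lt_b.
have /choice[c cP] i := countable_subset_card_le_II (b i).
have c_neq0 i : c i !=set0.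
  apply/set0P; have [_ _ /(_ 0%N)] := cP i; rewrite II0 !card_le0 => c_b.
  by apply: contra c_b _; exact/set0P.
exists (prodset c); last first.
  by apply: card_prodset_le_continuum => i; have [] := cP i.
split=> [x cx i|phi phiS]; first by have [+ _ _] := cP i; apply.
apply: exists_evt_avoids => //.
apply: filterS h_lt_b => i /andP[_ /negP nbh] cphi; apply: nbh.
have [_ _] := cP i; apply; apply: card_le_trans (subset_card_le cphi) _.
by have [] := phiS i.
Qed.

Lemma daLc_is_continuum b h N :
  (forall i, b i !=set0) -> (\forall i \near \oo, card_lt `I_(h i) (b i)) ->
  infinite_set (Bset b h N) -> daLc_is b h continuum.
Proof.
move=> b_neq0 h_lt_b BN; apply: least_size_Cantor_Bernstein.
  exact: avoiding_family_le_continuum.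
by move=> D; exact: avoiding_family_ge_continuum BN.
Qed.

Lemma h_ratio_ge0 (R : realType) b h i : 0 <= h_ratio R b h i.
Proof. by rewrite /h_ratio; case: asboolP => // _; rewrite divr_ge0. Qed.

Lemma h_ratio_notin_Bset (R : realType) b h N i :
  ~ Bset b h N i -> N%:R * h_ratio R b h i < 1.
Proof.
rewrite /h_ratio; case: asboolP => [[n bn]|_ _]; last by rewrite mulr0.
rewrite /Bset /= (card_fset_set bn) (card_le_eql bn) card_le_II => /negP.
rewrite -ltnNge => lt_n; have n_gt0 := leq_ltn_trans (leq0n _) lt_n.
by rewrite mulrA ltr_pdivrMr ?ltr0n// mul1r -natrM ltr_nat.
Qed.

Lemma exists_infinite_Bset (R : realType) b h :
  ~ (h_ratio R b h i @[i --> \oo] --> (0 : R)) ->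
  exists N, infinite_set (Bset b h N).
Proof.
apply: contra_notP => /forallNP Bfin; apply/cvgr0Pnorm_lt => eps eps_gt0.
pose N := Num.bound eps^-1.
have lt_N : eps^-1 < N%:R by apply: archi_boundP; rewrite invr_ge0 ltW.
have N_gt0 : 0 < N%:R :> R by apply: lt_trans lt_N; rewrite invr_gt0.
apply: filterS (finite_set_near_notin (contrapT (Bfin N))) => i.
move=> /(h_ratio_notin_Bset R); rewrite ger0_norm ?h_ratio_ge0//.
rewrite -ltr_pdivlMl// mulr1 => /lt_trans; apply.
by rewrite invf_plt ?posrE.
Qed.

End AntiLocalizationTheory.

Theorem theorem3p2 (R : realType) (T : choiceType)
  (b : nat -> set T) (h : nat -> nat)
  (b_neq0 : forall i, b i !=set0)
  (h_ge1 : \forall i \near \oo, (1 <= h i)%N)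
  (h_lt_b : \forall i \near \oo, card_lt `I_(h i) (b i))
  (ratio_ncvg0 : ~ (h_ratio R b h i @[i --> \oo] --> (0 : R))) :
  (exists N : nat,
    [/\ infinite_set (Bset b h N),
        (forall M : nat, infinite_set (Bset b h M) -> (N <= M)%N) &
        baLc_is b h `I_N]) /\
  daLc_is b h continuum.
Proof.
have exB : exists N, `[< infinite_set (Bset b h N) >].
  by have [N BN] := exists_infinite_Bset ratio_ncvg0; exists N; exact/asboolP.
have [N /asboolP BN Nmin] := ex_minnP exB.
have {}Nmin M : infinite_set (Bset b h M) -> (N <= M)%N by move=> /asboolP/Nmin.
split; first by exists N; split=> //; exact: baLc_is_least_Bset.
exact: daLc_is_continuum BN.
Qed.
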